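(* There is a $16\,CCZ\to2\,CCZ$ distillation protocol at distance $3$, given by the matrix $G\in\mathbb F_8^{5\times16}$ $$\left(\begin{array}{cccccccc|cccccccc} 0&\alpha&\alpha^2&\alpha^3&\alpha^4&\alpha^5&\alpha^6&1&0&0&0&0&0&0&0&0\\ 0&0&0&0&0&0&0&0&\alpha&\alpha^2&\alpha^3&\alpha^4&\alpha^5&\alpha^6&1&0\\\hline 1&\alpha^2&\alpha^4&\alpha^6&\alpha^8&\alpha^3&\alpha^5&1&0&0&0&0&0&0&0&0\\ 0&0&0&0&0&0&0&0&\alpha^2&\alpha^4&\alpha^6&\alpha^8&\alpha^3&\alpha^5&1&1\\ 0&1&1&1&1&1&1&1&1&1&1&1&1&1&1&0\end{array}\right)$$ with two logical rows (above the line) and three stabilizer rows. That is, $G$ has full rank and satisfies $$\sum_i(g_{a,i})^4(g_{b,i})^2g_{c,i}=\begin{cases}1&1\le a=b=c\le2\\0&\text{otherwise}\end{cases}\qquad(1\le a,b,c\le5);$$ consequently applying the norm gate $N$ ($CCZ$ up to Paulis) to each of the 16 physical qudits acts on the code as the logical $N^{\otimes2}$; and the $Z$-distance of the code is $3$.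
   Context: $\mathbb F_8=\mathbb F_2(\alpha)$ with $\alpha^3=\alpha+1$. An $\mathbb F_8$-qudit, with basis $|\gamma\rangle$, $\gamma\in\mathbb F_8$, is identified with three qubits via an $\mathbb F_2$-basis of $\mathbb F_8$. The norm gate is $N|\gamma\rangle=(-1)^{\gamma^7}|\gamma\rangle$ ($\gamma^7\in\{0,1\}$); up to global phase it equals $X^{\otimes3}\,CCZ\,X^{\otimes3}$. A full-rank matrix $G\in\mathbb F_8^{m\times n}$ with rows $\mathbf g_1,\dots,\mathbf g_m$ and $k$ logical rows defines a CSS code on $n$ qudits: the first $k$ rows are $X$-logical operators, the remaining rows generate the $X$-stabilizer space $\mathcal G_0$; logical basis states are $|\overline u\rangle\propto\sum_{\mathbf g\in\mathcal G_0}|\sum_{a\le k}u_a\mathbf g_a+\mathbf g\rangle$. ''Acts as the logical $N^{\otimes k}$'' means $N^{\otimes n}|\overline u\rangle=(-1)^{\sum_{a\le k}u_a^7}|\overline u\rangle$ for all $u\in\mathbb F_8^k$. The $Z$-distance is the minimum Hamming weight over $\mathbb F_8$ of a vector orthogonal (for $\sum x_iy_i$) to all stabilizer rows but not to at least one logical row. *)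

(* Defs.v *)
From HB Require Import structures.
From mathcomp Require Import all_boot all_order all_algebra.

Set Implicit Arguments.
Unset Strict Implicit.
Unset Printing Implicit Defensive.

Import Order.TTheory GRing.Theory Num.Theory.
Local Open Scope ring_scope.

Section States.
Variable C : numClosedFieldType.

(* The Hilbert space C^T with orthonormal basis |x>, x : T.  A register of n
   systems with basis T has basis 'rV[T]_n; this is used for T a finite field
   (qudits) and for T = bool (qubits). *)
Definition state (T : finType) := {ffun T -> C^o}.

Definition ket (T : finType) (x : T) : state T := [ffun y => (y == x)%:R].

(* Operators are given by their matrix entries: A y x = <y|A|x>. *)
Definition oper (T : finType) := T -> T -> C.

Definition apply_op (T : finType) (A : oper T) (psi : state T) : state T :=
  [ffun y => \sum_x A y x * psi x].

Definition comp_op (T : finType) (A B : oper T) : oper T :=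
  fun y x => \sum_z A y z * B z x.

Definition tensor_op (n : nat) (T : finType) (A : oper T) : oper 'rV[T]_n :=
  fun y x => \prod_(i < n) A (y 0 i) (x 0 i).

Definition X_gate : oper bool := fun y x => (y == ~~ x)%:R.

Definition CCZ_gate : oper 'rV[bool]_3 :=
  fun y x => (y == x)%:R * (-1) ^+ [forall i, x 0 i].

Definition XCCZX : oper 'rV[bool]_3 :=
  comp_op (tensor_op X_gate) (comp_op CCZ_gate (tensor_op X_gate)).

(* For #|F| = 8, g ^+ 7 is 0 or 1; norm_bit g is that value as a natural
   number (bool coerces to nat). *)
Definition norm_bit (F : finFieldType) (g : F) : nat := (g ^+ 7 == 1).

Definition norm_gate (F : finFieldType) : oper F :=
  fun y x => (y == x)%:R * (-1) ^+ norm_bit x.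

(* The identification of three qubits with F given by e_0, e_1, e_2: a bit
   string b is sent to \sum_i b_i e_i.  In characteristic 2, e is an F_2-basis
   of F when every element has unique coordinates in {0, 1}. *)
Definition of_bits (F : finFieldType) (e : 'I_3 -> F) (b : 'rV[bool]_3) : F :=
  \sum_i e i *+ b 0 i.

Definition is_F2_basis (F : finFieldType) (e : 'I_3 -> F) : Prop :=
  bijective (of_bits e).

Definition eq_up_to_phase (T : finType) (A B : oper T) : Prop :=
  exists2 c : C, `|c| = 1 & forall y x, A y x = c * B y x.

Section Code.
Variables (F : finFieldType) (k m n : nat) (G : 'M[F]_(k + m, n)).

(* usubmx G holds the k logical rows, dsubmx G the m stabilizer rows. *)

Definition stab_space : {set 'rV[F]_n} := [set g | (g <= dsubmx G)%MS].

Definition logical_ket (u : 'rV[F]_k) : state 'rV[F]_n :=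
  (sqrtC #|stab_space|%:R)^-1 *:
    \sum_(g in stab_space) ket (u *m usubmx G + g).

Definition acts_as_logical_norm : Prop :=
  forall u : 'rV[F]_k,
    apply_op (tensor_op (@norm_gate F)) (logical_ket u) =
    (-1) ^+ (\sum_(a < k) norm_bit (u ord0 a))%N *: logical_ket u.

End Code.
End States.

Section Distance.
Variables (F : finFieldType) (k m n : nat) (G : 'M[F]_(k + m, n)).

Definition dot (x y : 'rV[F]_n) : F := \sum_i x 0 i * y 0 i.

Definition weight (z : 'rV[F]_n) : nat := #|[set i | z 0 i != 0]|.

Definition nontrivial_Z (z : 'rV[F]_n) : Prop :=
  (forall j, dot (row j (dsubmx G)) z = 0) /\
  (exists a, dot (row a (usubmx G)) z != 0).

Definition Z_distance_is (d : nat) : Prop :=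
  (exists2 z, nontrivial_Z z & weight z = d) /\
  (forall z, nontrivial_Z z -> (d <= weight z)%N).

End Distance.

Definition Gmx (F : finFieldType) (al : F) : 'M[F]_(2 + 3, 16) :=
  \matrix_(i, j) nth 0 (nth [::]
   [:: [:: 0; al; al^+2; al^+3; al^+4; al^+5; al^+6; 1;
           0; 0; 0; 0; 0; 0; 0; 0];
       [:: 0; 0; 0; 0; 0; 0; 0; 0;
           al; al^+2; al^+3; al^+4; al^+5; al^+6; 1; 0];
       [:: 1; al^+2; al^+4; al^+6; al^+8; al^+3; al^+5; 1;
           0; 0; 0; 0; 0; 0; 0; 0];
       [:: 0; 0; 0; 0; 0; 0; 0; 0;
           al^+2; al^+4; al^+6; al^+8; al^+3; al^+5; 1; 1];
       [:: 0; 1; 1; 1; 1; 1; 1; 1;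
           1; 1; 1; 1; 1; 1; 1; 0]] i) j.

(* Main.v *)
Require Import Defs.
From HB Require Import structures.
From mathcomp Require Import all_boot all_order all_algebra.
From mathcomp Require Import all_fingroup all_solvable all_field ring.
Set Implicit Arguments.
Unset Strict Implicit.
Unset Printing Implicit Defensive.

Import Order.TTheory GRing.Theory Num.Theory.
Local Open Scope ring_scope.

(* In characteristic 2 squaring is additive, so x^7 = x^4 x^2 x is a trilinear
   form in disguise: for a codeword sum_a v_a g_a, the cubic identities turn the
   sum of the seventh powers of its entries into the sum of v_a^7 over the
   logical rows, which is the phase picked up under N.  Any two columns of the
   stabilizer rows are independent, so the Z-distance is at least 3, and columns
   0, 1, 2 give a logical operator of weight 3.  The finitely many identities
   between entries are checked by computation in F_2[X]/(X^3 + X + 1). *)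

(** * Seventh powers and parities in a field of order 8 *)

Section FieldOfOrder8.
Variables (F : finFieldType) (cardF : #|F| = 8%N).

Lemma pchar2_card8 : 2 \in [pchar F].
Proof.
(* Lagrange's theorem in the additive group gives 8 = 0, and 8 is the cube of 2. *)
have F8 : (1 : F) *+ 8 = 0.
  by rewrite -cardF -cardsT -FinRing.zmodXgE expg_cardG ?inE.
suff : (2%:R : F) ^+ 3 == 0 by rewrite expf_eq0 inE.
by rewrite -natrX F8.
Qed.

Lemma natr_norm_bit (g : F) : (norm_bit g)%:R = g ^+ 7.
Proof.
rewrite /norm_bit; have [->|g0] := eqVneq g 0.
  by rewrite expr0n /= eq_sym oner_eq0.
suff -> : g ^+ 7 = 1 by rewrite eqxx.
by apply: (mulfI g0); rewrite mulr1 -exprS -cardF expf_card.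
Qed.

Lemma norm_bitE (g : F) : norm_bit g = (g != 0) :> nat.
Proof.
have [->|g0] := eqVneq g 0; first by rewrite /norm_bit expr0n eq_sym oner_eq0.
have := natr_norm_bit g; rewrite /norm_bit; case: eqP => // _ /esym/eqP.
by rewrite expf_eq0 (negPf g0).
Qed.

Lemma natr_odd (n : nat) : n%:R = (odd n)%:R :> F.
Proof.
by rewrite -{1}(odd_double_half n) natrD -mul2n natrM (pcharf0 pchar2_card8)
  mul0r addr0.
Qed.

Lemma odd_eq_natr (p q : nat) : p%:R = q%:R :> F -> odd p = odd q.
Proof.
rewrite natr_odd (natr_odd q) => /eqP.
by case: (odd p) (odd q) => [] [] //=; rewrite ?(eq_sym 0) oner_eq0.
Qed.

Lemma expr7_sum (I : finType) (f : I -> F) :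
  (\sum_a f a) ^+ 7 =
  \sum_a \sum_b \sum_c f a ^+ 4 * f b ^+ 2 * f c.
Proof.
have sq (g : I -> F) : (\sum_a g a) ^+ 2 = \sum_a g a ^+ 2.
  exact: (rmorph_sum (pFrobenius_aut pchar2_card8)).
transitivity ((\sum_a f a ^+ 4) * (\sum_b f b ^+ 2) * \sum_c f c).
  have -> : \sum_a f a ^+ 4 = (\sum_a f a) ^+ 4.
    by rewrite (exprM _ 2 2) !sq; apply: eq_bigr => a _; rewrite -exprM.
  by rewrite -sq -exprD -exprSr.
rewrite mulr_suml mulr_suml; apply: eq_bigr => a _.
rewrite mulr_sumr mulr_suml; apply: eq_bigr => b _.
by rewrite mulr_sumr.
Qed.

(** A sign depends only on a parity, and parities can be compared in [F], where 2 = 0 and 1 is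
    nonzero. The counts become sums of seventh powers, whose trilinear expansion keeps only the
    terms with a = b = c < k. *)
Lemma sum_norm_bit_code (k m n : nat) (G : 'M[F]_(k + m, n))
    (v : 'rV[F]_(k + m)) :
  (forall a b c : 'I_(k + m),
     \sum_i (G a i) ^+ 4 * (G b i) ^+ 2 * G c i =
     if [&& a == b, b == c & (a < k)%N] then 1 else 0) ->
  odd (\sum_i norm_bit ((v *m G) ord0 i)) =
  odd (\sum_(a < k) norm_bit (lsubmx v ord0 a)).
Proof.
move=> cubic; apply: odd_eq_natr; rewrite !natr_sum.
under eq_bigr do rewrite natr_norm_bit mxE expr7_sum.
under [RHS]eq_bigr do rewrite natr_norm_bit mxE.
transitivity (\sum_a \sum_b \sum_c v 0 a ^+ 4 * v 0 b ^+ 2 * v 0 c *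
    (if [&& a == b, b == c & (a < k)%N] then 1 else 0)).
  rewrite exchange_big; apply: eq_bigr => a _.
  rewrite exchange_big; apply: eq_bigr => b _.
  rewrite exchange_big; apply: eq_bigr => c _.
  by rewrite -cubic mulr_sumr; apply: eq_bigr => i _; ring.
transitivity (\sum_(a < k + m) if (a < k)%N then v 0 a ^+ 7 else 0).
  apply: eq_bigr => a _; rewrite (big_only1 a) //= => [|b ba _]; last first.
    by rewrite big1 // => c _; rewrite (eq_sym a b) (negPf ba) mulr0.
  rewrite (big_only1 a) //= => [|c ca _]; last first.
    by rewrite (eq_sym a c) (negPf ca) andbF mulr0.
  by rewrite eqxx /=; case: ifP => _; rewrite ?mulr0 // mulr1; ring.
rewrite big_split_ord /= addrC big1 ?add0r => [|i _].
  by apply: eq_bigr => a _; rewrite ltn_ord.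
by rewrite ltnNge leq_addr.
Qed.

End FieldOfOrder8.

(** * Diagonal action of the norm gate on logical states *)

Lemma apply_tensor_norm_gate (C : numClosedFieldType) (F : finFieldType)
    (n : nat) (psi : state C 'rV[F]_n) (y : 'rV[F]_n) :
  apply_op (tensor_op (@norm_gate C F)) psi y =
  (-1) ^+ (\sum_i norm_bit (y ord0 i))%N * psi y.
Proof.
rewrite ffunE (big_only1 y) //= => [|x xy _].
  congr (_ * _); rewrite /tensor_op /norm_gate -prodrXr.
  by apply: eq_bigr => i _; rewrite eqxx mul1r.
suff [i yxi] : exists i, y 0 i != x 0 i.
  by rewrite /tensor_op (bigD1 i) //= /norm_gate (negPf yxi) !mul0r.
apply/existsP; apply: contraNT xy => /existsPn yx; apply/eqP/rowP => i.
by have /negbNE/eqP := yx i.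
Qed.

Lemma acts_as_logical_norm_cubic (C : numClosedFieldType) (F : finFieldType)
    (cardF : #|F| = 8%N) (k m n : nat) (G : 'M[F]_(k + m, n)) :
  (forall a b c : 'I_(k + m),
     \sum_i (G a i) ^+ 4 * (G b i) ^+ 2 * G c i =
     if [&& a == b, b == c & (a < k)%N] then 1 else 0) ->
  acts_as_logical_norm C G.
Proof.
move=> cubic u; apply/ffunP => y; rewrite apply_tensor_norm_gate.
rewrite /logical_ket !ffunE /GRing.scale /= [LHS]mulrCA [RHS]mulrCA.
congr (_ * _).
rewrite !sum_ffunE !mulr_sumr; apply: eq_bigr => g; rewrite inE => /submxP[w ->].
rewrite ffunE; case: eqP => [->|_]; last by rewrite !mulr0.
(* Every basis vector in the support is a codeword with logical coordinates [u], so all of them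
   receive the same sign. *)
have -> : u *m usubmx G + w *m dsubmx G = row_mx u w *m G.
  by rewrite -mul_row_col vsubmxK.
by rewrite -signr_odd (sum_norm_bit_code cardF _ cubic) row_mxKl signr_odd.
Qed.

(** * The norm gate as a conjugate of CCZ *)

Lemma tensor_X_gate (C : numClosedFieldType) (n : nat) (y x : 'rV[bool]_n) :
  tensor_op (X_gate C) y x = (y == map_mx negb x)%:R.
Proof.
rewrite /tensor_op /X_gate -natr_prod; congr _%:R.
have [->|yx] := eqVneq y (map_mx negb x).
  by rewrite big1 // => i _; rewrite mxE eqxx.
suff [i yxi] : exists i, y 0 i != ~~ x 0 i by rewrite (bigD1 i) //= (negPf yxi).
apply/existsP; apply: contraNT yx => /existsPn yx; apply/eqP/rowP => i.
by have /negbNE/eqP-> := yx i; rewrite mxE.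
Qed.

(** Flipping all bits moves the sign of CCZ from the all-ones string to the all-zeros string. *)
Lemma XCCZXE (C : numClosedFieldType) (y x : 'rV[bool]_3) :
  XCCZX C y x = (y == x)%:R * (-1) ^+ (x == const_mx false).
Proof.
have negK : involutive (@map_mx _ _ negb 1 3).
  by move=> z; apply/rowP => i; rewrite !mxE negbK.
rewrite /XCCZX /comp_op (big_only1 (map_mx negb y)) //= => [|z zy _]; last first.
  by rewrite tensor_X_gate eq_sym (inv_eq negK) (negPf zy) mul0r.
rewrite (big_only1 (map_mx negb x)) //= => [|z zx _]; last first.
  by rewrite tensor_X_gate (negPf zx) mulr0.
rewrite !tensor_X_gate !negK !eqxx mul1r mulr1 /CCZ_gate.
rewrite (inj_eq (inv_inj negK)); congr (_ * (-1) ^+ nat_of_bool _).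
apply/forallP/eqP => [x0|-> i]; last by rewrite !mxE.
by apply/rowP => i; have := x0 i; rewrite !mxE => /negPf.
Qed.

Lemma norm_gate_XCCZX (C : numClosedFieldType) (F : finFieldType)
    (cardF : #|F| = 8%N) (e : 'I_3 -> F) :
  is_F2_basis e ->
  eq_up_to_phase (fun y x => @norm_gate C F (of_bits e y) (of_bits e x))
    (@XCCZX C).
Proof.
(* N negates exactly the nonzero basis states and the conjugated CCZ only the zero one, whence the
   phase -1. *)
move=> /bij_inj e_inj; exists (-1); first by rewrite normrN1.
move=> y x; rewrite XCCZXE /norm_gate norm_bitE // (inj_eq e_inj).
have <- : of_bits e (const_mx false) = 0.
  by rewrite /of_bits big1 // => i _; rewrite mxE.
by rewrite (inj_eq e_inj) mulrCA signrN mulN1r mulrN.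
Qed.

(** * Lower bound on weights from independent pairs of columns *)

Lemma weight_gt2 (F : finFieldType) (m n : nat) (S : 'M[F]_(m, n))
    (z : 'rV[F]_n) :
  (1 < n)%N ->
  (forall i j, i != j -> exists r s, S r i * S s j != S s i * S r j) ->
  (forall r, dot (row r S) z = 0) -> z != 0 -> (2 < weight z)%N.
Proof.
move=> n_gt1 minorS Sz /rV0Pn[i zi]; rewrite ltnNge; apply/negP => wz.
have [j ij zj] : exists2 j, i != j & forall l, l != i -> l != j -> z 0 l = 0.
  have [j /andP[ji zj]|no] := pickP [pred l | (l != i) && (z 0 l != 0)].
    exists j; first by rewrite eq_sym.
    move=> l li lj; apply/eqP; apply: contraLR wz => zl; rewrite -ltnNge.
    have <- : #|[set l; j; i]| = 3%N.
      by rewrite -setUA cardsU1 !inE cards2 ji (negPf li) (negPf lj).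
    by apply/subset_leq_card/subsetP => x; rewrite !inE => /orP[/orP[]|] /eqP->.
  (* If [z] is supported on [i] alone, any other index serves as [j]; [1 < n] provides one. *)
  have /card_gt0P[j] : (0 < #|predC1 i|)%N.
    by rewrite cardC1 card_ord -subn1 subn_gt0.
  rewrite inE /= => ji; exists j => [|l li _]; first by rewrite eq_sym.
  by have := no l; rewrite /= li => /negbFE/eqP.
have Sij r : S r i * z 0 i + S r j * z 0 j = 0.
  rewrite -[RHS](Sz r) /dot (bigD1 i) //= (bigD1 j) 1?eq_sym //= big1 ?addr0.
    by rewrite !mxE.
  by move=> l /andP[li lj]; rewrite zj ?mulr0.
(* Eliminating [z 0 j] between the relations for rows [r] and [s] leaves the minor times [z 0 i], so
   the minor would vanish. *)
have [r [s /eqP[]]] := minorS i j ij; apply: (mulIf zi); apply/eqP.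
rewrite -subr_eq0.
have -> : S r i * S s j * z 0 i - S s i * S r j * z 0 i =
  S s j * (S r i * z 0 i + S r j * z 0 j)
  - S r j * (S s i * z 0 i + S s j * z 0 j) by ring.
by rewrite !Sij !mulr0 subrr.
Qed.

(* (a, b, c) stands for a + b al + c al^2. *)
Definition gf8 : Type := (bool * bool * bool)%type.
Definition zero8 : gf8 := (false, false, false).
Definition one8 : gf8 := (true, false, false).
Definition al8 : gf8 := (false, true, false).

Definition add8 (x y : gf8) : gf8 :=
  let: (a0, a1, a2) := x in let: (b0, b1, b2) := y in
  (a0 (+) b0, a1 (+) b1, a2 (+) b2).

(** [c3] and [c4] are the coefficients of al^3 and al^4, reduced by al^3 = 1 + al and al^4 = al +
    al^2. *)
Definition mul8 (x y : gf8) : gf8 :=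
  let: (a0, a1, a2) := x in let: (b0, b1, b2) := y in
  let c3 := a1 && b2 (+) a2 && b1 in
  let c4 := a2 && b2 in
  (a0 && b0 (+) c3,
   a0 && b1 (+) a1 && b0 (+) c3 (+) c4,
   a0 && b2 (+) a1 && b1 (+) a2 && b0 (+) c4).

Definition exp8 (x : gf8) (n : nat) : gf8 := iter n (mul8 x) one8.

Arguments exp8 : simpl never.

Definition sum8 (n : nat) (f : nat -> gf8) : gf8 :=
  foldr (fun i => add8 (f i)) zero8 (iota 0 n).

Definition G8 (i j : nat) : gf8 := nth zero8 (nth [::]
  [:: zero8 :: [seq exp8 al8 n | n <- [:: 1; 2; 3; 4; 5; 6; 0]%N] ++ nseq 8 zero8;
      nseq 8 zero8 ++ [seq exp8 al8 n | n <- [:: 1; 2; 3; 4; 5; 6; 0]%N]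
        ++ [:: zero8];
      one8 :: [seq exp8 al8 n | n <- [:: 2; 4; 6; 8; 3; 5; 0]%N] ++ nseq 8 zero8;
      nseq 8 zero8 ++ [seq exp8 al8 n | n <- [:: 2; 4; 6; 8; 3; 5; 0]%N]
        ++ [:: one8];
      zero8 :: nseq 14 one8 ++ [:: zero8]] i) j.

(* A right inverse of G8: column j expresses the unit vector e_j by columns of G8.
   Columns 0 and 15 are e_2 and e_3, the sum of columns 1 and 2 (resp. 8 and 9)
   only involves e_0 and e_2 (resp. e_1 and e_3), and column 1 then gives e_4. *)
Definition Ginv8 (i j : nat) : gf8 :=
  match j, i with
  | 0, 0 => exp8 al8 4 | 0, 1 => exp8 al8 3 | 0, 2 => exp8 al8 3
  | 1, 15 => exp8 al8 4 | 1, 8 => exp8 al8 3 | 1, 9 => exp8 al8 3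
  | 2, 0 => one8
  | 3, 15 => one8
  | 4, 0 => exp8 al8 3 | 4, 1 => exp8 al8 5 | 4, 2 => exp8 al8 4
  | _, _ => zero8
  end.

Lemma all_iota_ord (n : nat) (P : pred nat) :
  all P (iota 0 n) -> forall i : 'I_n, P i.
Proof. by move=> /allP Ps i; apply: Ps; rewrite mem_iota ltn_ord. Qed.

(** * Transfer from boolean triples to the field, and the checks on the matrix *)

Section Evaluation.
Variables (F : finFieldType) (al : F).
Hypotheses (cardF : #|F| = 8%N) (al_eq : al ^+ 3 = al + 1).

Definition ev8 (x : gf8) : F :=
  let: (a, b, c) := x in a%:R + b%:R * al + c%:R * al ^+ 2.
Arguments ev8 : simpl never.

Lemma natr_addb (a b : bool) : (a (+) b)%:R = a%:R + b%:R :> F.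
Proof.
case: a b => [] []; rewrite ?addr0 ?add0r //.
by rewrite (addrr_pchar2 (pchar2_card8 cardF)).
Qed.

Lemma natr_andb (a b : bool) : (a && b)%:R = a%:R * b%:R :> F.
Proof. by case: a; rewrite ?mul1r ?mul0r. Qed.

Lemma ev8_zero : ev8 zero8 = 0.
Proof. by rewrite /ev8 /= !mul0r !addr0. Qed.

Lemma ev8_one : ev8 one8 = 1.
Proof. by rewrite /ev8 /= !mul0r !addr0. Qed.

Lemma ev8_al : ev8 al8 = al.
Proof. by rewrite /ev8 /= mul0r mul1r addr0 add0r. Qed.

Lemma ev8D x y : ev8 (add8 x y) = ev8 x + ev8 y.
Proof. by case: x y => [[? ?] ?] [[? ?] ?]; rewrite /ev8 /= !natr_addb; ring. Qed.

Lemma ev8M x y : ev8 (mul8 x y) = ev8 x * ev8 y.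
Proof.
by case: x y => [[? ?] ?] [[? ?] ?]; rewrite /ev8 /= !(natr_addb, natr_andb);
  ring: al_eq.
Qed.

Lemma ev8X x n : ev8 (exp8 x n) = ev8 x ^+ n.
Proof. by elim: n => [|n IHn]; [exact: ev8_one | rewrite exprS -IHn -ev8M]. Qed.

Lemma ev8_alX n : ev8 (exp8 al8 n) = al ^+ n.
Proof. by rewrite ev8X ev8_al. Qed.

Lemma ev8_sum n (f : nat -> gf8) : \sum_(i < n) ev8 (f i) = ev8 (sum8 n f).
Proof.
rewrite -(big_mkord xpredT (fun i => ev8 (f i))) /index_iota subn0 /sum8.
elim: (iota 0 n) => [|i s IHs]; rewrite ?big_nil ?ev8_zero //.
by rewrite big_cons IHs -ev8D.
Qed.

Lemma ev8_eq0 x : (ev8 x == 0) = (x == zero8).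
Proof.
apply/eqP/eqP => [x0|->]; last exact: ev8_zero.
apply/eqP; apply: contraT => xn0.
(* Case analysis shows that each nonzero triple has seventh power [one8], so its value cannot be
   0. *)
suff : ev8 (exp8 x 7) = 1.
  by rewrite ev8X x0 expr0n => /esym/eqP; rewrite oner_eq0.
by rewrite -ev8_one; congr ev8; case: x xn0 {x0} => [[[] []] []].
Qed.

Lemma ev8_inj : injective ev8.
Proof.
move=> x y /eqP; rewrite -subr_eq0 (oppr_pchar2 (pchar2_card8 cardF)).
rewrite -ev8D ev8_eq0.
by case: x y => [[[] []] []] [[[] []] []].
Qed.

Lemma Gmx_ev8 i j : Gmx al i j = ev8 (G8 i j).
Proof.
have nth_ev8 s l : nth 0 [seq ev8 x | x <- s] l = ev8 (nth zero8 s l).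
  have [ls|sl] := ltnP l (size s); first exact: nth_map.
  by rewrite !nth_default ?size_map // ev8_zero.
rewrite mxE /G8 -nth_ev8; congr nth.
by case: i => [[|[|[|[|[|i]]]]] lt_i5] //=; rewrite ?ev8_alX ?ev8_one ?ev8_zero.
Qed.

Lemma sum_cubic_Gmx (a b c : 'I_(2 + 3)) :
  \sum_(i < 16) (Gmx al a i) ^+ 4 * (Gmx al b i) ^+ 2 * Gmx al c i =
  if [&& a == b, b == c & (a < 2)%N] then 1 else 0.
Proof.
pose cubic8 a b c := sum8 16 (fun i =>
  mul8 (mul8 (exp8 (G8 a i) 4) (exp8 (G8 b i) 2)) (G8 c i)).
(* All 125 identities are decided on boolean triples, then carried to [F] by [ev8]. *)
have /all_iota_ord/(_ a)/all_iota_ord/(_ b)/all_iota_ord/(_ c)/eqP cubicE :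
    all (fun a => all (fun b => all (fun c => cubic8 a b c ==
      if [&& a == b, b == c & (a < 2)%N] then one8 else zero8)
    (iota 0 5)) (iota 0 5)) (iota 0 5) by vm_compute.
transitivity (ev8 (cubic8 a b c)); last first.
  by rewrite cubicE (fun_if ev8) ev8_one ev8_zero.
by rewrite -ev8_sum; apply: eq_bigr => i _; rewrite !Gmx_ev8 -!ev8X -!ev8M.
Qed.

Lemma rank_Gmx : \rank (Gmx al) = 5%N.
Proof.
suff /eqP : row_free (Gmx al) by [].
apply/row_freeP; exists (\matrix_(i, j) ev8 (Ginv8 i j)).
have /all_iota_ord GK : all (fun a => all (fun b =>
    sum8 16 (fun i => mul8 (G8 a i) (Ginv8 i b)) ==
    if a == b then one8 else zero8) (iota 0 5)) (iota 0 5) by vm_compute.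
apply/matrixP => a b; have /all_iota_ord/(_ b)/eqP GKab := GK a; rewrite !mxE.
have -> : (a == b)%:R = ev8 (if val a == val b then one8 else zero8).
  by rewrite val_eqE; case: eqP; rewrite ?ev8_one ?ev8_zero.
by rewrite -GKab -ev8_sum; apply: eq_bigr => i _; rewrite Gmx_ev8 mxE ev8M.
Qed.

Lemma Z_distance_Gmx : Z_distance_is (Gmx al) 3.
Proof.
split=> [|z [Sz [a Lz]]].
  (* On columns 0, 1, 2 the stabilizer rows give al + al^2 + al^4 = 0, 0 and 1 + 1 = 0, while the
     first logical row gives al + al^2 = al^4, which is nonzero. *)
  pose z8 := nth zero8 [:: al8; one8; one8].
  pose dot8 r := sum8 16 (fun i => mul8 (G8 r i) (z8 i)).
  have dotE (x : 'rV_16) (r : 'I_(2 + 3)) :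
      x = row r (Gmx al) -> dot x (\row_i ev8 (z8 i)) = ev8 (dot8 r).
    move=> ->; rewrite -ev8_sum; apply: eq_bigr => i _.
    by rewrite ev8M -Gmx_ev8 mxE; congr (_ * _); rewrite mxE.
  exists (\row_i ev8 (z8 i)); first split.
  - move=> r; rewrite (dotE _ (rshift 2 r)) ?row_dsubmx //.
    apply/eqP; rewrite ev8_eq0; move: r.
    by apply: (@all_iota_ord 3 (fun r => dot8 (2 + r)%N == zero8)); vm_compute.
  - exists ord0; rewrite (dotE _ (lshift 3 ord0)) ?row_usubmx // ev8_eq0.
    by vm_compute.
  rewrite /weight -sum1dep_card big_mkcond /=.
  under eq_bigr do rewrite mxE ev8_eq0.
  rewrite -(big_mkord xpredT (fun i => if z8 i != zero8 then 1 else 0)%N).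
  by rewrite unlock.
apply: (@weight_gt2 _ _ _ (dsubmx (Gmx al))) => //; last first.
  apply: contra_neq Lz => ->.
  by rewrite /dot big1 // => i _; rewrite [X in _ * X]mxE mulr0.
(* Columns from different halves are separated by the first two stabilizer rows. Within a half, the
   block row and the last row give eight distinct points of the projective line. *)
have /all_iota_ord minor8 : all (fun i => all (fun j => (i != j) ==>
    has (fun r => has (fun s => mul8 (G8 (2 + r)%N i) (G8 (2 + s)%N j)
      != mul8 (G8 (2 + s)%N i) (G8 (2 + r)%N j)) (iota 0 3)) (iota 0 3))
    (iota 0 16)) (iota 0 16) by vm_compute.
move=> i j ij; have /all_iota_ord/(_ j)/implyP/(_ ij) := minor8 i.
case/hasP=> r; rewrite mem_iota => /andP[_ r3] /hasP[s].
rewrite mem_iota => /andP[_ s3].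
rewrite -(inj_eq ev8_inj) !ev8M => minor_rs.
have dE r' i' : dsubmx (Gmx al) r' i' = ev8 (G8 (2 + r')%N i').
  by rewrite [LHS]mxE Gmx_ev8.
by exists (Ordinal r3), (Ordinal s3); rewrite !dE.
Qed.

End Evaluation.

Theorem mainTheorem8 (C : numClosedFieldType) (F : finFieldType) (al : F)
    (cardF : #|F| = 8%N) (al_eq : al ^+ 3 = al + 1) :
  (* full rank *)
  \rank (Gmx al) = 5%N
  (* the cubic identities *)
  /\ (forall a b c : 'I_(2 + 3),
        \sum_(i < 16) (Gmx al a i) ^+ 4 * (Gmx al b i) ^+ 2 * Gmx al c i =
        if [&& a == b, b == c & (a < 2)%N] then 1 else 0)
  (* N is CCZ up to Paulis and a global phase, for any F_2-basis of F *)
  /\ (forall e : 'I_3 -> F, is_F2_basis e ->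
        eq_up_to_phase
          (fun y x => @norm_gate C F (of_bits e y) (of_bits e x))
          (@XCCZX C))
  (* N applied to the 16 physical qudits acts as the logical N on 2 qudits *)
  /\ acts_as_logical_norm C (Gmx al)
  (* the Z-distance is 3 *)
  /\ Z_distance_is (Gmx al) 3.
Proof.
split; first exact: rank_Gmx.
split; first exact: sum_cubic_Gmx.
split; first by move=> e; apply: norm_gate_XCCZX.
split; last exact: Z_distance_Gmx.
by apply: acts_as_logical_norm_cubic => //; exact: sum_cubic_Gmx.
Qed.
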